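(* There are distributions of $X$ and $Y$ on $\{1,\ldots,N\}$, in which $X$ and $Y$ are independent and uniformly distributed over sets of numbers having only small and distinct prime factors, for which $$H(X,Y\mid X\cdot Y) = \Omega\left(\frac{\log N}{\log\log N}\right).$$ Consequently, the upper bound $H(X,Y\mid X\cdot Y) = O(\log N/\log\log N)$, which holds for any distributions of $X$ and $Y$ on $\{1,\ldots,N\}$, is the best possible bound.
   Context: $X$ and $Y$ are random integers taking values in $\{1,\ldots,N\}$, and $X \cdot Y$ denotes their ordinary integer product. $H$ denotes Shannon entropy with logarithms to base 2. $H(X,Y\mid X\cdot Y)$ is the conditional entropy (equivocation) of the ordered pair $(X,Y)$ given the product $X\cdot Y$, that is, the information lost in multiplication; since $X \cdot Y$ is determined by $(X,Y)$, it equals $H(X,Y) - H(X\cdot Y)$. The notations $O$ and $\Omega$ refer to $N \to \infty$. A number has distinct prime factors if no prime occurs more than once in its factorization; the word ''small'' is descriptive, and the statement attaches no specific numerical bound to it. *)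

(* Defs.v *)
From HB Require Import structures.
From mathcomp Require Import all_boot all_order all_algebra finmap.
From mathcomp Require Import all_classical all_reals all_analysis.

Set Implicit Arguments.
Unset Strict Implicit.
Unset Printing Implicit Defensive.

Import Order.TTheory GRing.Theory Num.Theory.
Import numFieldNormedType.Exports.

Local Open Scope classical_set_scope.
Local Open Scope ring_scope.

Definition log2 (R : realType) (x : R) : R := ln x / ln 2.

(* Probability distributions on a finite sample space.  Random variables with
   values in {1, ..., N} need nothing larger: their joint law has finite
   support. *)
Record fdist (R : realType) (Omega : finType) := FDist {
  fdist_fun :> Omega -> R;
  fdist_ge0 : forall w, 0 <= fdist_fun w;
  fdist_sum1 : \sum_(w : Omega) fdist_fun w = 1 }.

Section RandomVariables.
Variables (R : realType) (Omega : finType) (P : fdist R Omega).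

Definition Pr (E : pred Omega) : R := \sum_(w | E w) P w.

(* Pr [E | F]; the value when Pr F = 0 is irrelevant, since condEntropy
   multiplies it by Pr F. *)
Definition condPr (E F : pred Omega) : R := Pr (predI E F) / Pr F.

Definition entropy_given (U : eqType) (X : Omega -> U) (F : pred Omega) : R :=
  - \sum_(u <- undup (codom X))
      condPr (fun w => X w == u) F * log2 (condPr (fun w => X w == u) F).

(* H(X | Z) = \sum_z Pr [Z = z] * H(X | Z = z) *)
Definition condEntropy (U V : eqType) (X : Omega -> U) (Z : Omega -> V) : R :=
  \sum_(z <- undup (codom Z))
    Pr (fun w => Z w == z) * entropy_given X (fun w => Z w == z).

Definition independent (U V : eqType) (X : Omega -> U) (Y : Omega -> V) :
    Prop :=
  forall u v, Pr (fun w => (X w == u) && (Y w == v)) =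
              Pr (fun w => X w == u) * Pr (fun w => Y w == v).

(* This forces A to be nonempty, as the probabilities sum to 1. *)
Definition uniform_on (A : {fset nat}) (X : Omega -> nat) : Prop :=
  forall a, Pr (fun w => X w == a) = if a \in A then (#|` A|%:R)^-1 else 0.

(* H(X, Y | X * Y) *)
Definition mul_loss (X Y : Omega -> nat) : R :=
  condEntropy (fun w => (X w, Y w)) (fun w => (X w * Y w)%N).

End RandomVariables.

Definition ranges_in (N : nat) (Omega : finType) (X : Omega -> nat) : Prop :=
  forall w, (1 <= X w <= N)%N.

Definition distinct_prime_factors (n : nat) : Prop :=
  forall p, (logn p n <= 1)%N.

Definition prime_factors_le (y n : nat) : Prop :=
  forall p, p \in primes n -> (p <= y)%N.

(* y N = N ^ o(1): the threshold below which a prime counts as small. *)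
Definition subpolynomial (R : realType) (y : nat -> nat) : Prop :=
  (fun N : nat => log2 (y N)%:R / log2 N%:R : R) @ \oo --> (0 : R).

Definition loss_scale (R : realType) (N : nat) : R :=
  log2 N%:R / log2 (log2 N%:R).

(* H(X, Y | X * Y) = O(f N), uniformly over all joint distributions of X and Y
   on {1, ..., N}. *)
Definition loss_bigO (R : realType) (f : nat -> R) : Prop :=
  exists C : R, \forall N \near \oo,
    forall (Omega : finType) (P : fdist R Omega) (X Y : Omega -> nat),
      ranges_in N X -> ranges_in N Y -> mul_loss P X Y <= C * `|f N|.

(* Main.v *)
Require Import Defs.
From HB Require Import structures.
From mathcomp Require Import all_boot all_order all_algebra finmap.
From mathcomp Require Import all_classical all_reals all_analysis.
From mathcomp Require Import zify ring lra.

Set Implicit Arguments.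
Unset Strict Implicit.
Unset Printing Implicit Defensive.

Import Order.TTheory GRing.Theory Num.Theory.
Import numFieldNormedType.Exports.

(** Entropy enters only through two estimates of [H(X, Y | X * Y)].

    Upper bound.  Given [X * Y = z], the pair [(X, Y)] is determined by [X],
    which is a divisor of [z], so at most [log2 d(z)] bits are lost
    ([mul_loss_le]), where [d(z)] is the number of divisors of [z].  For
    [z <= N ^ 2] the divisor bound gives
    [log2 d(z) = O(log N / log log N)] ([exists_size_divisors_bound]).

    Lower bound.  Let [D] be a product of [k] distinct primes and let [X] and
    [Y] be independent and uniform on the [2 ^ k] divisors of [D].  There are
    [4 ^ k] equally likely pairs, whereas the product divides [D ^ 2] and hence
    takes at most [d(D ^ 2) = 3 ^ k] values.  The loss is therefore at least
    [k * log2 (4 / 3)] ([mul_loss_pairs_ge]).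

    It remains to find [k] of order [log N / log log N] with [D <= N]
    ([exists_primes_prod_le]).  Every prime power exactly dividing the binomial
    coefficient ['C(2n, n) >= 2 ^ n] is at most [2n], so at least
    [n / log2 (2n)] distinct primes divide it, all of them at most [2n].  Taking
    [n] to be about [log2 N], any [log N / log (2n)] of these primes have a
    product of at most [N], and they are below [2 log2 N = N ^ o(1)].

    Both halves of the number theory are stated over the natural numbers, with
    [L = trunc_log 2 N] and [M = trunc_log 2 L] in place of [log2 N] and
    [log2 (log2 N)]; [loss_scale_bounds] says that [L / M] and [loss_scale N]
    agree up to a factor [2].  The optimality of the scale follows by combining
    the lower bound with any upper bound valid for all distributions. *)

(** * Counting divisors *)

Lemma size_divisors n :
  size (divisors n) = \prod_(p <- primes n) (logn p n).+1.
Proof.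
rewrite /divisors prime_decompE.
elim: (primes n) => [|p s IHs] /=; first by rewrite big_nil.
rewrite big_cons -IHs; move: (foldr _ _ _) => divs.
elim: (logn p n) => [|e IHe] /=; first by rewrite mul1n.
by rewrite size_merge size_cat size_map IHe -mulSnr.
Qed.

Lemma prod_pfactors n : 0 < n -> \prod_(p <- primes n) p ^ logn p n = n.
Proof. by move=> n0; rewrite [RHS]prod_prime_decomp // prime_decompE big_map. Qed.

(** In [d(n) = \prod_p (e_p + 1)], the at most [2 ^ j] primes below [2 ^ j]
    contribute a factor [e_p + 1 <= a + 1] each.  For the others
    [e_p + 1 <= 2 ^ e_p], and the [e_p] add up to at most [a / j] because
    each of these primes is at least [2 ^ j] while [n <= 2 ^ a]. *)
Lemma size_divisors_le n a j : 0 < n -> n <= 2 ^ a -> 0 < j ->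
  size (divisors n) <= a.+1 ^ (2 ^ j) * 2 ^ (a %/ j).
Proof.
move=> n_gt0 le_n_2a j_gt0.
have prime_n p : p \in primes n -> prime p by rewrite mem_primes => /andP[].
rewrite size_divisors (bigID (fun p => p < 2 ^ j)) /=; apply: leq_mul.
  apply: (@leq_trans (\prod_(p <- primes n | p < 2 ^ j) a.+1)).
    rewrite big_seq_cond [leqRHS]big_seq_cond.
    apply: leq_prod => p /andP[/prime_n p_pr _].
    rewrite ltnS -(@leq_exp2l 2) // (leq_trans _ le_n_2a) //.
    apply: (@leq_trans (p ^ logn p n)).
      by case: (logn p n) => [//|e]; rewrite leq_exp2r ?prime_gt1.
    by rewrite dvdn_leq // pfactor_dvdnn.
  rewrite big_const_seq iter_muln_1 leq_pexp2l // -size_filter.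
  rewrite -[leqRHS](size_iota 0) uniq_leq_size ?filter_uniq ?primes_uniq //.
  by move=> p; rewrite mem_filter mem_iota add0n => /andP[].
apply: (@leq_trans (\prod_(p <- primes n | ~~ (p < 2 ^ j)) 2 ^ logn p n)).
  by apply: leq_prod => p _; apply: ltn_expl.
rewrite -expn_sum leq_pexp2l // leq_divRL // -(@leq_exp2l 2) //.
apply: leq_trans le_n_2a; rewrite mulnC expnM expn_sum -[leqRHS]prod_pfactors //.
rewrite [leqRHS](bigID (fun p => p < 2 ^ j)) /= -[leqLHS]mul1n leq_mul //.
  rewrite big_seq_cond; apply: prodn_cond_gt0 => p /andP[/prime_n p_pr _].
  by rewrite expn_gt0 prime_gt0.
apply: leq_prod => p; rewrite -leqNgt => le_2j_p.
by case: (logn p n) => [//|e]; rewrite leq_exp2r.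
Qed.

(** * Many small primes *)

(** By Vandermonde, ['C(2n, n)] is the sum of the squares of the ['C(n, i)],
    whose sum is [2 ^ n]. *)
Lemma exp2_le_central_bin n : 2 ^ n <= 'C(n.*2, n).
Proof.
rewrite -addnn -binomial.Vandermonde.
rewrite -{1}[2]/(1 + 1) expnDn; apply: leq_sum => i _.
by rewrite !exp1n !muln1 leq_pmulr // bin_gt0 leq_subr.
Qed.

(** By Legendre's formula the exponent of [p] in ['C(2n, n)] is the sum over
    [k >= 1] of [2n / p ^ k - 2 (n / p ^ k)] (integer quotients); each summand is
    at most [1], and it vanishes once [p ^ k > 2n]. *)
Lemma pfactor_central_bin_le n p : 0 < n -> prime p ->
  p ^ logn p 'C(n.*2, n) <= n.*2.
Proof.
move=> n_gt0 p_pr.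
have p_gt1 := prime_gt1 p_pr.
apply: leq_trans (trunc_logP p_gt1 _); last by rewrite double_gt0.
rewrite leq_pexp2l ?prime_gt0 // -(leq_add2r (logn p (n`! * (n.*2 - n)`!))).
rewrite -lognM ?bin_gt0 ?muln_gt0 ?fact_gt0 //; last by rewrite -addnn leq_addr.
rewrite bin_fact; last by rewrite -addnn leq_addr.
rewrite -addnn addnK addnn lognM ?fact_gt0 // !logn_fact //.
set t := trunc_log p n.*2.
(* Both Legendre sums are taken over the same range. *)
have widen : \sum_(1 <= k < n.+1) n %/ p ^ k = \sum_(1 <= k < n.*2.+1) n %/ p ^ k.
  rewrite [RHS](big_cat_nat (n := n.+1)) //=; last by rewrite ltnS -addnn leq_addr.
  rewrite [X in _ + X]big1_seq ?addn0 // => k /andP[_]; rewrite mem_index_iota.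
  case/andP=> n_lt_k _; rewrite divn_small //.
  by apply: leq_trans n_lt_k (ltnW _); apply: ltn_expl.
have count_pow : \sum_(1 <= k < n.*2.+1) (k <= t) <= t.
  have t_le : t.+1 <= n.*2.+1.
    rewrite ltnS; apply: leq_trans (ltnW (ltn_expl t p_gt1)) _.
    by apply: trunc_logP => //; rewrite double_gt0.
  rewrite (big_cat_nat (n := t.+1)) //= [X in _ + X]big1_seq ?addn0.
    rewrite (@eq_big_seq _ _ _ _ _ _ (fun=> 1)) => [|k].
      by rewrite sum_nat_const_nat muln1 subn1.
    by rewrite mem_index_iota => /andP[_]; rewrite ltnS => ->.
  by move=> k; rewrite mem_index_iota => /andP[_ /andP[tk _]]; rewrite leqNgt tk.
rewrite widen -!big_split /=.
apply: leq_trans (leq_add count_pow (leqnn _)); rewrite -big_split /=.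
apply: leq_sum => k _.
have pk_gt0 : 0 < p ^ k by rewrite expn_gt0 prime_gt0.
case: (leqP k t) => [_|t_lt_k].
  have := divn_eq n (p ^ k); have := ltn_pmod n pk_gt0.
  move: (n %/ _) (n %% _) => q r r_lt n_eq.
  by rewrite -ltnS ltn_divLR // n_eq -!muln2; nia.
rewrite divn_small //; apply: leq_trans (trunc_log_ltn _ p_gt1) _.
by rewrite leq_pexp2l ?prime_gt0.
Qed.

(** A weak form of Chebyshev's lower bound for the number of primes up to
    [2n]; the primes are the prime divisors of ['C(2n, n)]. *)
Lemma exists_small_primes n : 0 < n -> exists s : seq nat,
  [/\ uniq s, all prime s, all (fun p => p <= n.*2) s
    & 2 ^ n <= n.*2 ^ size s].
Proof.
move=> n_gt0; exists (primes 'C(n.*2, n)).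
have bin_gt0 : 0 < 'C(n.*2, n) by rewrite bin_gt0 -addnn leq_addr.
split; first exact: primes_uniq.
- by apply/allP => p; rewrite mem_primes => /andP[].
- apply/allP => p p_dv; have p_pr : prime p by move: p_dv; rewrite mem_primes => /andP[].
  apply: leq_trans (pfactor_central_bin_le n_gt0 p_pr).
  by rewrite -{1}[p]expn1 leq_pexp2l ?(prime_gt0 p_pr) ?logn_gt0.
apply: leq_trans (exp2_le_central_bin n) _; rewrite -{1}[X in X <= _]prod_pfactors //.
apply: (@leq_trans (\prod_(p <- primes 'C(n.*2, n)) n.*2)).
  rewrite big_seq [leqRHS]big_seq; apply: leq_prod => p; rewrite mem_primes.
  by case/and3P=> p_pr _ _; apply: pfactor_central_bin_le.
by rewrite big_const_seq iter_muln_1 count_predT.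
Qed.

(** * Products of distinct primes *)

Lemma prod_primes_gt0 (s : seq nat) : all prime s -> 0 < \prod_(p <- s) p.
Proof.
move=> /allP s_prime; rewrite big_seq.
by apply: prodn_cond_gt0 => p /s_prime /prime_gt0.
Qed.

Section ProductOfPrimes.
Variable s : seq nat.
Hypotheses (s_uniq : uniq s) (s_prime : all prime s).

Lemma logn_prod_primes p : logn p (\prod_(q <- s) q) = (p \in s).
Proof.
elim: s s_uniq s_prime => [|q r IHr] /=; first by rewrite big_nil logn1.
case/andP=> q_notin r_uniq /andP[q_pr r_pr]; rewrite big_cons inE.
rewrite lognM ?(prime_gt0 q_pr) ?prod_primes_gt0 // IHr // logn_prime //.
by case: eqVneq => [->|] //=; rewrite (negPf q_notin).
Qed.

Lemma primes_prod_primes : perm_eq (primes (\prod_(p <- s) p)) s.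
Proof.
apply: uniq_perm => // [|p]; first exact: primes_uniq.
by rewrite -logn_gt0 logn_prod_primes; case: (p \in s).
Qed.

Lemma size_divisors_prod_primes : size (divisors (\prod_(p <- s) p)) = 2 ^ size s.
Proof.
rewrite size_divisors (perm_big _ primes_prod_primes) big_seq.
under eq_bigr => p ps do rewrite logn_prod_primes ps.
by rewrite -big_seq big_const_seq iter_muln_1 count_predT.
Qed.

Lemma size_divisors_sqr_prod_primes :
  size (divisors ((\prod_(p <- s) p) ^ 2)) = 3 ^ size s.
Proof.
rewrite size_divisors primesX // (perm_big _ primes_prod_primes) big_seq.
under eq_bigr => p ps do rewrite lognX logn_prod_primes ps.
by rewrite -big_seq big_const_seq iter_muln_1 count_predT.
Qed.

End ProductOfPrimes.

(** * Number theory at the scale [log N / log log N] *)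

(** The divisor bound [size_divisors_le] for [z <= N ^ 2 < 2 ^ (2 * L.+1)], with
    the primes cut at [2 ^ (M / 2)], about the square root of [log2 N]: the
    primes below the cut then contribute only about [M * 2 ^ (M / 2)] to the
    exponent, and those above it [O(L / M)]. *)
Lemma exists_size_divisors_bound N : let L := trunc_log 2 N in
  let M := trunc_log 2 L in 1 < M ->
  exists2 e, e * M <= 22 * L &
    forall z, 0 < z -> z <= N ^ 2 -> size (divisors z) <= 2 ^ e.
Proof.
move=> L M M_ge2.
have L_gt0 : 0 < L by move: M_ge2; rewrite /M; case: (L).
have N_gt0 : 0 < N by move: L_gt0; rewrite /L; case: (N).
have L_lt : L < 2 ^ M.+1 := trunc_log_ltn L (ltnSn 1).
have L_ge : 2 ^ M <= L := trunc_logP (ltnSn 1) L_gt0.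
pose j := M./2; have j_gt0 : 0 < j by rewrite half_gt0.
have M_eq : M = odd M + j.*2 by rewrite odd_double_half.
exists ((M + 3) * 2 ^ j + (2 * L.+1) %/ j); last first.
  move=> z z_gt0 z_le; have z_le2 : z <= 2 ^ (2 * L.+1).
    by rewrite mulnC expnM (leq_trans z_le) // leq_exp2r // ltnW // trunc_log_ltn.
  apply: leq_trans (size_divisors_le z_gt0 z_le2 j_gt0) _.
  rewrite expnD leq_mul // expnM leq_exp2r ?expn_gt0 // addnS !expnS.
  move: L_lt; rewrite expnS addn2 !expnS; lia.
have odd_le1 : odd M <= 1 by case: odd.
have small_part : (2 * j + 4) * (2 * j + 1) <= 10 * 2 ^ j.
  elim: j j_gt0 {M_eq} => // -[//|j] IHj _.
  have := IHj isT; rewrite [2 ^ j.+2]expnS.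
  by case: (j) => [|[|[|i]]] //; lia.
have sqr_le : 2 ^ j * 2 ^ j <= L.
  by rewrite -expnD (leq_trans _ L_ge) // leq_pexp2l //; lia.
have part1 : (M + 3) * 2 ^ j * M <= 10 * L.
  have : (M + 3) * M <= 10 * 2 ^ j by apply: leq_trans small_part; rewrite leq_mul //; lia.
  move: (2 ^ j) sqr_le => T; nia.
have part2 : (2 * L.+1) %/ j * M <= 3 * (2 * L.+1).
  have := leq_trunc_div (2 * L.+1) j; move: (_ %/ _) => q; nia.
rewrite mulnDl; lia.
Qed.

(** All the primes found are at most [2L < 2 ^ M.+2], so [k = L / M.+2] of them
    have a product of at most [2 ^ L <= N]; the bound [2 ^ L <= (2L) ^ size s]
    guarantees that there are that many. *)
Lemma exists_primes_prod_le N : let L := trunc_log 2 N in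
  let M := trunc_log 2 L in 2 <= M ->
  exists s : seq nat, [/\ uniq s, all prime s, all (fun p => p <= L.*2) s,
    \prod_(p <- s) p <= N & L <= 4 * size s * M].
Proof.
move=> L M M_ge2.
have L_gt0 : 0 < L by move: M_ge2; rewrite /M; case: (L).
have N_gt0 : 0 < N by move: L_gt0; rewrite /L; case: (N).
have L_lt : L < 2 ^ M.+1 := trunc_log_ltn L (ltnSn 1).
have L_ge : 2 ^ M <= L := trunc_logP (ltnSn 1) L_gt0.
have [s [s_uniq s_prime s_le s_large]] := exists_small_primes L_gt0.
have L2_le : L.*2 <= 2 ^ M.+2 by move: L_lt; rewrite [2 ^ M.+2]expnS; lia.
have L_le_size : L <= M.+2 * size s.
  rewrite -(@leq_exp2l 2) // (leq_trans s_large) // expnM.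
  by case: (size s) => [//|k]; rewrite leq_exp2r.
pose k := L %/ M.+2.
have k_le : k <= size s by rewrite -(mulKn (size s) (ltn0Sn M.+1)) leq_div2r.
have M2_le_L : M.+2 <= L.
  apply: leq_trans L_ge; case: M M_ge2 {L_lt L2_le L_le_size k k_le} => [|[|m]] // _.
  elim: m => // m IHm; rewrite expnS; lia.
have k_gt0 : 0 < k by rewrite divn_gt0.
have size_take_k : size (take k s) = k.
  by rewrite size_take_min; apply/minn_idPl.
have sub_s : {subset take k s <= s} := @mem_take _ _ _.
exists (take k s); split.
- exact: take_uniq.
- by apply/allP => p /sub_s /(allP s_prime).
- by apply/allP => p /sub_s /(allP s_le).
- apply: leq_trans (trunc_logP (ltnSn 1) N_gt0); rewrite -/L.
  apply: (@leq_trans (\prod_(p <- take k s) 2 ^ M.+2)); last first.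
    rewrite big_const_seq iter_muln_1 count_predT size_take_k -expnM.
    by rewrite leq_pexp2l // mulnC leq_trunc_div.
  rewrite big_seq [leqRHS]big_seq; apply: leq_prod => p /sub_s /(allP s_le) p_le.
  exact: leq_trans p_le L2_le.
rewrite size_take_k.
have := ltn_ceil L (isT : 0 < M.+2); rewrite -/k; nia.
Qed.

Local Open Scope classical_set_scope.
Local Open Scope ring_scope.

(** * Conditional entropy *)

Section Entropy.
Variable R : realType.

Lemma ln2_gt0 : 0 < ln 2 :> R.
Proof. by rewrite ln_gt0 // ltr1n. Qed.

(** The convex function [x * ln x] lies above its tangent at [a].  Both entropy
    estimates below sum this inequality, so it plays the part of Jensen's
    inequality, and it includes the convention [0 * ln 0 = 0]. *)
Lemma xlnx_ge_tangent (a x : R) : 0 < a -> 0 <= x ->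
  x * ln a + x - a <= x * ln x.
Proof.
move=> a_gt0; rewrite le_eqVlt => /predU1P[<-|x_gt0].
  by rewrite !mul0r !add0r oppr_le0 ltW.
have ax_gt0 : 0 < a / x by rewrite divr_gt0.
have : ln (1 + (a / x - 1)) <= a / x - 1 by apply: le_ln1Dx; lra.
rewrite addrC subrK ln_div ?posrE // => /(ler_wpM2l (ltW x_gt0)).
have -> : x * (a / x - 1) = a - x by field; rewrite gt_eqF.
lra.
Qed.

Variables (Omega : finType) (P : fdist R Omega).

Lemma Pr_ge0 (E : pred Omega) : 0 <= Pr P E.
Proof. by apply: sumr_ge0 => w _; apply: fdist_ge0. Qed.

Lemma sum_Pr_fibers (U : eqType) (X : Omega -> U) (F : pred Omega) :
  \sum_(u <- undup (codom X)) Pr P (predI (fun w => X w == u) F) = Pr P F.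
Proof.
rewrite /Pr; under eq_bigr do rewrite big_mkcond.
rewrite exchange_big [RHS]big_mkcond; apply: eq_bigr => w _ /=.
rewrite (bigD1_seq (X w)) ?undup_uniq ?mem_undup ?codom_f //= eqxx /=.
rewrite big1 ?addr0 // => u; rewrite eq_sym => /negPf ->.
by [].
Qed.

Lemma sum_Pr_values (V : eqType) (Z : Omega -> V) :
  \sum_(z <- undup (codom Z)) Pr P (fun w => Z w == z) = 1.
Proof.
rewrite -(fdist_sum1 P) -[RHS](sum_Pr_fibers Z predT); apply: eq_bigr => z _.
by apply: eq_bigl => w /=; rewrite andbT.
Qed.

Lemma sum_condPr (U : eqType) (X : Omega -> U) (F : pred Omega) :
  Pr P F != 0 ->
  \sum_(u <- undup (codom X)) condPr P (fun w => X w == u) F = 1.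
Proof. by move=> F_neq0; rewrite -mulr_suml sum_Pr_fibers divff. Qed.

(** The entropy of a law supported on at most [m] values is at most [log2 m]:
    compare it with the uniform law by taking tangents at [1 / m], at the points
    of the support only. *)
Lemma entropy_given_le (U : eqType) (X : Omega -> U) (F : pred Omega) m :
  Pr P F != 0 -> (0 < m)%N ->
  (size [seq u <- undup (codom X) | condPr P (fun w => X w == u) F != 0%R]
     <= m)%N ->
  entropy_given P X F <= log2 m%:R.
Proof.
move=> F_neq0 m_gt0 support_le; have ln2 := ln2_gt0.
rewrite /entropy_given /log2 ler_pdivlMr //.
rewrite mulNr mulr_suml.
have mR_gt0 : 0 < m%:R :> R by rewrite ltr0n.
set q := fun u => condPr P (fun w => X w == u) F.
have term u : - (q u * ln m%:R) + q u - (if q u != 0 then m%:R^-1 else 0)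
    <= q u * (ln (q u) / ln 2) * ln 2.
  rewrite mulrA divfK ?(gt_eqF ln2) //.
  case: (eqVneq (q u) 0) => [->|_]; first by rewrite !mul0r /= subr0 addr0 oppr0.
  have -> : - (q u * ln m%:R) = q u * ln m%:R^-1 by rewrite lnV ?posrE // mulrN.
  by apply: xlnx_ge_tangent; rewrite ?invr_gt0 // divr_ge0 ?Pr_ge0.
have sum_le : \sum_(u <- undup (codom X))
    (- (q u * ln m%:R) + q u - (if q u != 0 then m%:R^-1 else 0))
  <= \sum_(u <- undup (codom X)) q u * (ln (q u) / ln 2) * ln 2.
  by apply: ler_sum => u _; apply: term.
rewrite lerNl; apply: le_trans sum_le.
rewrite !big_split /= !sumrN -mulr_suml sum_condPr // mul1r.
rewrite -big_mkcond /= -big_filter big_const_seq count_predT iter_addr_0.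
rewrite -[_ *+ size _]mulr_natl.
suff : (size [seq u <- undup (codom X) | q u != 0])%:R / m%:R <= 1 :> R by lra.
by rewrite ler_pdivrMr // mul1r ler_nat.
Qed.

(** A pair with product [z] is [(d, z / d)] for a divisor [d] of [z]. *)
Lemma mul_loss_le (X Y : Omega -> nat) m : (0 < m)%N ->
  (forall w, 0 < X w * Y w)%N ->
  (forall w, size (divisors (X w * Y w)) <= m)%N ->
  mul_loss P X Y <= log2 m%:R.
Proof.
move=> m_gt0 XY_gt0 div_le; rewrite /mul_loss /condEntropy.
rewrite -[leRHS]mul1r -[X in _ <= X * _](sum_Pr_values (fun w => X w * Y w)%N).
rewrite mulr_suml.
rewrite big_seq [leRHS]big_seq; apply: ler_sum => z.
rewrite mem_undup => /codomP[w0 z_eq].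
have [->|F_neq0] := eqVneq (Pr P (fun w => (X w * Y w)%N == z)) 0.
  by rewrite !mul0r.
apply: ler_wpM2l; first exact: Pr_ge0.
apply: entropy_given_le => //.
have z_gt0 : (0 < z)%N by rewrite z_eq.
apply: leq_trans (_ : size [seq (d, z %/ d)%N | d <- divisors z] <= m)%N; last first.
  by rewrite size_map z_eq.
apply: uniq_leq_size => [|u]; first by rewrite filter_uniq ?undup_uniq.
rewrite mem_filter => /andP[u_neq0 _].
have [w /andP[/eqP <- /eqP w_z]] :
    exists w, ((X w, Y w) == u) && ((X w * Y w)%N == z).
  apply/existsP; apply: contra_neqT u_neq0; rewrite negb_exists => /forallP no_w.
  by rewrite /condPr /Pr big_pred0 ?mul0r // => w; apply/negbTE/no_w.
have Xw_gt0 : (0 < X w)%N by move: (XY_gt0 w); rewrite muln_gt0 => /andP[].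
apply/mapP; exists (X w); last by rewrite -w_z mulKn.
by rewrite -dvdn_divisors // -w_z dvdn_mulr.
Qed.

(** This is [H(X | Z) >= H(X) - log2 m] for a uniform [X].  On the fiber [Z = z],
    which has [f z] points, [X] is uniform, so its entropy is [log2 (f z)]; the
    mean of [log2 (f z)] is smallest when there are [m] equally large fibers, that
    is, when [f z = n / m] where [n] is the size of the sample space. *)
Lemma condEntropy_uniform_ge (U V : eqType) (X : Omega -> U) (Z : Omega -> V) m :
  (forall w, P w = #|Omega|%:R^-1) -> injective X -> (0 < m)%N ->
  (size (undup (codom Z)) <= m)%N ->
  log2 (#|Omega|%:R / m%:R) <= condEntropy P X Z.
Proof.
move=> P_unif X_inj m_gt0 Z_le; have ln2 := ln2_gt0.
have n_gt0 : 0 < #|Omega|%:R :> R.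
  rewrite ltr0n lt0n; apply/eqP => /card0_eq Omega0.
  have /eqP := fdist_sum1 P; rewrite big_pred0 => [|w]; first by rewrite eq_sym oner_eq0.
  by have := Omega0 w; rewrite inE.
set n : R := #|Omega|%:R in P_unif n_gt0 *.
have mR_gt0 : 0 < m%:R :> R by rewrite ltr0n.
pose f z : R := n * Pr P (fun w => Z w == z).
have f_gt0 z : z \in undup (codom Z) -> 0 < f z.
  rewrite mem_undup => /codomP[w ->]; rewrite mulr_gt0 // /Pr (bigD1 w) //=.
  by rewrite ltr_wpDr ?sumr_ge0 // => *; rewrite P_unif ?invr_ge0 ?invr_gt0 // ltW.
have entropyE z : z \in undup (codom Z) ->
    entropy_given P X (fun w => Z w == z) = log2 (f z).
  move=> z_in; have fz_gt0 := f_gt0 z z_in.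
  have F_neq0 : Pr P (fun w => Z w == z) != 0.
    by apply: contraTneq fz_gt0 => F0; rewrite /f F0 mulr0 ltxx.
  rewrite /entropy_given -[RHS]mulr1 -(sum_condPr X F_neq0) mulr_sumr -sumrN.
  apply: eq_bigr => u _; set q := condPr _ _ _.
  have [->|q_neq0] := eqVneq q 0; first by rewrite mul0r mulr0 oppr0.
  suff -> : q = (f z)^-1 by rewrite /log2 lnV ?posrE //; ring.
  have [w /andP[/eqP Xw /eqP Zw]] : exists w, (X w == u) && (Z w == z).
    apply/existsP; apply: contra_neqT q_neq0; rewrite negb_exists => /forallP no_w.
    by rewrite /q /condPr /Pr big_pred0 ?mul0r // => w; apply/negbTE/no_w.
  rewrite /q /condPr /f invfM; congr (_ / _).
  rewrite /Pr (big_pred1 w) ?P_unif // => w' /=.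
  apply/andP/eqP => [[/eqP Xw' _]|->]; last by rewrite Xw Zw !eqxx.
  by apply: X_inj; rewrite Xw Xw'.
rewrite /condEntropy (eq_big_seq (fun z => f z * ln (f z) / (n * ln 2))); last first.
  move=> z z_in; rewrite entropyE // /log2 /f.
  by field; rewrite !gt_eqF.
pose a := n / m%:R; have a_gt0 : 0 < a by rewrite divr_gt0.
have sum_f : \sum_(z <- undup (codom Z)) f z = n.
  by rewrite -mulr_sumr sum_Pr_values mulr1.
have sum_ge : \sum_(z <- undup (codom Z)) (f z * ln a + f z - a)
    <= \sum_(z <- undup (codom Z)) f z * ln (f z).
  rewrite big_seq [leRHS]big_seq; apply: ler_sum => z z_in.
  by apply: xlnx_ge_tangent => //; rewrite ltW ?f_gt0.
rewrite -mulr_suml ler_pdivlMr ?mulr_gt0 //; apply: le_trans sum_ge.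
rewrite !big_split /= -mulr_suml sum_f sumrN big_const_seq count_predT iter_addr_0.
rewrite -/a /log2 -[_ *+ size _]mulr_natl.
have -> : ln a / ln 2 * (n * ln 2) = n * ln a by field; rewrite gt_eqF.
suff : (size (undup (codom Z)))%:R * a <= n by lra.
rewrite /a mulrA ler_pdivrMr // mulrC ler_wpM2l ?ler_nat //; exact: ltW.
Qed.

End Entropy.

(** * Independent uniform pairs *)

Section UniformPairs.
Variable R : realType.

Section Uniform.
Variables (T : finType) (T_gt0 : (0 < #|T|)%N).

Let unif_ge0 (t : T) : 0 <= #|T|%:R^-1 :> R.
Proof. by rewrite invr_ge0 ler0n. Qed.

Let unif_sum1 : \sum_(t : T) #|T|%:R^-1 = 1 :> R.
Proof. by rewrite sumr_const cardT -cardE -[LHS]mulr_natl divff // pnatr_eq0 -lt0n. Qed.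

Definition uniform_fdist : fdist R T := FDist unif_ge0 unif_sum1.

Lemma Pr_uniform (E : pred T) : Pr uniform_fdist E = #|E|%:R / #|T|%:R.
Proof. by rewrite /Pr /= sumr_const mulr_natl. Qed.

End Uniform.

Section Pairs.
Variable A : {fset nat}.
Hypothesis A_gt0 : (0 < #|` A|)%N.

Lemma card_pairs : #|{: A * A}| = (#|` A| * #|` A|)%N.
Proof. by rewrite card_prod -!cardfE. Qed.

Lemma card_pairs_gt0 : (0 < #|{: A * A}|)%N.
Proof. by rewrite card_pairs muln_gt0 A_gt0. Qed.

Definition pair_fdist : fdist R {: A * A} := uniform_fdist card_pairs_gt0.

Lemma card_fsval_eq a : #|[pred d : A | fsval d == a]| = (a \in A).
Proof.
case: (boolP (a \in A)) => [aA|aNA].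
  rewrite -[RHS](card1 (FSetSub aA)); apply: eq_card => d.
  by rewrite !inE.
rewrite eq_card0 // => d; rewrite !inE; apply: contraNF aNA => /eqP <-; apply: fsvalP.
Qed.

Lemma card_pairs_pred (E F : pred A) :
  #|[pred w : A * A | E w.1 && F w.2]| = (#|E| * #|F|)%N.
Proof. by rewrite -cardX; apply: eq_card => w; rewrite !inE. Qed.

Lemma Pr_pair_fdist (E F : pred A) :
  Pr pair_fdist (fun w => E w.1 && F w.2) =
    (#|E|%:R / #|` A|%:R) * (#|F|%:R / #|` A|%:R).
Proof.
rewrite Pr_uniform card_pairs_pred card_pairs !natrM.
by rewrite invfM mulrACA.
Qed.

Let A_neq0 : #|` A|%:R != 0 :> R. Proof. by rewrite pnatr_eq0 -lt0n. Qed.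

Lemma Pr_fst_eq a :
  Pr pair_fdist (fun w => fsval w.1 == a) = (a \in A)%:R / #|` A|%:R.
Proof.
have := Pr_pair_fdist [pred d : A | fsval d == a] predT.
rewrite card_fsval_eq -cardfE divff // mulr1 => <-.
by apply: eq_bigl => w; rewrite andbT.
Qed.

Lemma Pr_snd_eq a :
  Pr pair_fdist (fun w => fsval w.2 == a) = (a \in A)%:R / #|` A|%:R.
Proof.
have := Pr_pair_fdist predT [pred d : A | fsval d == a].
by rewrite card_fsval_eq -cardfE divff // mul1r => <-.
Qed.

Lemma uniform_on_fst : uniform_on pair_fdist A (fun w => fsval w.1).
Proof. by move=> a; rewrite Pr_fst_eq; case: (a \in A); rewrite ?mul1r ?mul0r. Qed.

Lemma uniform_on_snd : uniform_on pair_fdist A (fun w => fsval w.2).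
Proof. by move=> a; rewrite Pr_snd_eq; case: (a \in A); rewrite ?mul1r ?mul0r. Qed.

Lemma independent_pairs :
  independent pair_fdist (fun w => fsval w.1) (fun w => fsval w.2).
Proof.
move=> u v; rewrite Pr_fst_eq Pr_snd_eq.
have := Pr_pair_fdist [pred d : A | fsval d == u] [pred d : A | fsval d == v].
by rewrite !card_fsval_eq.
Qed.

(** There are [#|` A| ^ 2] equally likely pairs, while the products are divisors
    of [n]. *)
Lemma mul_loss_pairs_ge n : (0 < n)%N ->
  (forall a b, a \in A -> b \in A -> (a * b %| n)%N) ->
  log2 ((#|` A| * #|` A|)%:R / (size (divisors n))%:R)
    <= mul_loss pair_fdist (fun w => fsval w.1) (fun w => fsval w.2).
Proof.
move=> n_gt0 A_dvd; rewrite -card_pairs; apply: condEntropy_uniform_ge => //.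
- by move=> [a b] [a' b'] [/val_inj -> /val_inj ->].
- by case: (divisors n) (divisor1 n).
apply: uniq_leq_size => [|z]; first exact: undup_uniq.
rewrite mem_undup => /codomP[[a b] ->]; rewrite -dvdn_divisors //.
by apply: A_dvd; apply: fsvalP.
Qed.

End Pairs.
End UniformPairs.

(** * Asymptotics *)

Section Asymptotics.
Variable R : realType.

Definition small_prime_bound (N : nat) : nat := (trunc_log 2 N).*2.

(** Each prime of the construction accounts for [log2 4 - log2 3] bits, and the
    number of primes is at least [loss_scale R N / 8]. *)
Definition loss_constant : R := log2 (4 / 3) / 8.

Lemma loss_constant_gt0 : 0 < loss_constant.
Proof.
rewrite /loss_constant /log2 !divr_gt0 ?ln2_gt0 // ln_gt0 //.
by rewrite ltr_pdivlMr // mul1r ltr_nat.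
Qed.

Lemma le_log2 (x y : R) : 0 < x -> x <= y -> log2 x <= log2 y.
Proof.
move=> x_gt0 xy; rewrite ler_pM2r ?invr_gt0 ?ln2_gt0 //.
by rewrite ler_ln // posrE (lt_le_trans x_gt0).
Qed.

Lemma log2_exp (x : R) k : 0 < x -> log2 (x ^+ k) = k%:R * log2 x.
Proof. by move=> x_gt0; rewrite /log2 lnXn // -[ln x *+ k]mulr_natl mulrA. Qed.

Lemma log2_exp2 k : log2 (2 ^ k)%:R = k%:R :> R.
Proof. by rewrite natrX log2_exp // /log2 divff ?mulr1 // gt_eqF ?ln2_gt0. Qed.

Lemma log2_nat_bounds n : (0 < n)%N ->
  (trunc_log 2 n)%:R <= log2 n%:R :> R /\ log2 n.+1%:R <= (trunc_log 2 n).+1%:R :> R.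
Proof.
move=> n_gt0; have /andP[n_ge n_lt] := trunc_log_bounds (ltnSn 1) n_gt0.
split.
  by rewrite -[leLHS]log2_exp2 le_log2 ?ltr0n ?ler_nat ?expn_gt0.
by rewrite -[leRHS]log2_exp2 le_log2 ?ltr0n ?ler_nat.
Qed.

Lemma loglog_gt1 N : (1 < trunc_log 2 (trunc_log 2 N))%N ->
  (0 < trunc_log 2 N)%N /\ (0 < N)%N.
Proof.
move=> M_ge2; have L_gt0 : (0 < trunc_log 2 N)%N by move: M_ge2; case: (trunc_log 2 N).
by split => //; case: N L_gt0 {M_ge2}.
Qed.

Lemma log2_N_bounds N : let L := trunc_log 2 N in (0 < N)%N ->
  L%:R <= log2 N%:R :> R /\ log2 N%:R <= L.+1%:R :> R.
Proof.
move=> L N_gt0; have [? N_le] := log2_nat_bounds N_gt0; split=> //.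
by apply: le_trans N_le; rewrite le_log2 ?ltr0n ?ler_nat.
Qed.

Lemma loss_scale_bounds N : let L := trunc_log 2 N in let M := trunc_log 2 L in
  (1 < M)%N ->
  L%:R <= 2 * M%:R * loss_scale R N /\ M%:R * loss_scale R N <= 2 * L%:R.
Proof.
move=> L M M_ge2; have [L_gt0 N_gt0] := loglog_gt1 M_ge2.
have [LN NL] := log2_N_bounds N_gt0; rewrite -/L in LN NL.
have [ML LM] := log2_nat_bounds L_gt0; rewrite -/M in ML LM.
have L_ge1 : 1 <= L%:R :> R by rewrite ler1n.
have M_ge2' : 2 <= M%:R :> R by rewrite ler_nat.
have loglog_ge : M%:R <= log2 (log2 N%:R) :> R.
  by apply: le_trans ML _; rewrite le_log2 // ltr0n.
have loglog_le : log2 (log2 N%:R) <= M.+1%:R :> R.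
  by apply: le_trans LM; rewrite le_log2 //; lra.
rewrite /loss_scale; set u := log2 N%:R in LN NL loglog_ge loglog_le *.
set v := log2 u in loglog_ge loglog_le *.
rewrite -natr1 in loglog_le; rewrite -natr1 in NL.
have v_gt0 : 0 < v by lra.
split; rewrite mulrA.
  by rewrite ler_pdivlMr //; nra.
by rewrite ler_pdivrMr //; nra.
Qed.

Lemma loss_scale_ge0 N : (1 < trunc_log 2 (trunc_log 2 N))%N ->
  0 <= loss_scale R N.
Proof.
move=> M_ge2; have [L_le _] := loss_scale_bounds M_ge2.
have M_gt0 : 0 < (trunc_log 2 (trunc_log 2 N))%:R :> R by rewrite ltr0n ltnW.
have M2_gt0 : 0 < 2 * (trunc_log 2 (trunc_log 2 N))%:R :> R by rewrite mulr_gt0.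
by rewrite -(pmulr_rge0 _ M2_gt0) (le_trans _ L_le).
Qed.

Lemma near_loglog m :
  \forall N \near \oo, (m <= trunc_log 2 (trunc_log 2 N))%N.
Proof.
exists (2 ^ 2 ^ m)%N => // N /= N_ge.
by apply: trunc_log_max => //; apply: trunc_log_max.
Qed.

(** The ratio is at most [M.+2 / L], and [M.+2 ^ 2 <= 8 * 2 ^ M <= 8 * L] makes it
    at most [8 / M.+2]. *)
Lemma subpolynomial_small_prime_bound : subpolynomial R small_prime_bound.
Proof.
apply/cvgrPdist_le => e e_gt0.
have [m m_gt] : exists m : nat, 8 / e < m%:R.
  by exists (Num.bound (8 / e)); apply: archi_boundP; rewrite divr_ge0 // ltW.
apply: filterS (near_loglog (maxn 2 m)) => N; rewrite geq_max => /andP[M_ge2 m_le].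
have [L_gt0 N_gt0] := loglog_gt1 M_ge2.
have [LN _] := log2_N_bounds N_gt0.
set L := trunc_log 2 N in M_ge2 m_le L_gt0 LN *; set M := trunc_log 2 L in M_ge2 m_le.
have L_ge : (2 ^ M <= L)%N := trunc_logP (ltnSn 1) L_gt0.
have L_lt : (L < 2 ^ M.+1)%N := trunc_log_ltn L (ltnSn 1).
have sqr_le : (M.+2 ^ 2 <= 8 * L)%N.
  apply: leq_trans (_ : 8 * 2 ^ M <= _)%N; last by rewrite leq_mul2l.
  elim: (M) => // -[//|i]; rewrite -!mulnn [(2 ^ i.+2)%N]expnS; nia.
have y_ge : 0 <= log2 (small_prime_bound N)%:R :> R.
  by rewrite divr_ge0 ?ln_ge0 ?ler1n ?double_gt0 // ltW ?ln2_gt0.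
have y_le : log2 (small_prime_bound N)%:R <= M.+2%:R :> R.
  rewrite -[leRHS]log2_exp2 le_log2 ?ler_nat ?ltr0n ?double_gt0 //.
  by rewrite /small_prime_bound -/L expnS mul2n leq_double ltnW.
have L_gt0' : 0 < L%:R :> R by rewrite ltr0n.
have logN_gt0 : 0 < log2 N%:R :> R by exact: lt_le_trans LN.
rewrite distrC subr0 (ger0_norm (divr_ge0 y_ge (ltW logN_gt0))) ler_pdivrMr //.
apply: le_trans y_le _.
have {}sqr_le : M.+2%:R * M.+2%:R <= 8 * L%:R :> R.
  by rewrite -!natrM ler_nat mulnn.
have M_ge : m%:R <= M.+2%:R :> R by rewrite ler_nat; lia.
have M_gt0 : 0 < M.+2%:R :> R by rewrite ltr0n.
move: m_gt; rewrite ltr_pdivrMr // => m_gt.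
have e_ge : 8 <= M.+2%:R * e by apply: le_trans (ltW m_gt) _; rewrite ler_pM2r.
rewrite -(ler_pM2l M_gt0); apply: le_trans sqr_le _.
by rewrite mulrA ler_pM.
Qed.

Lemma exists_large_mul_loss N : (1 < trunc_log 2 (trunc_log 2 N))%N ->
  exists (A B : {fset nat}) (Omega : finType) (P : fdist R Omega)
         (X Y : Omega -> nat),
    [/\ (forall n, n \in A \/ n \in B ->
           [/\ (1 <= n <= N)%N, distinct_prime_factors n
             & prime_factors_le (small_prime_bound N) n]),
        ranges_in N X /\ ranges_in N Y,
        uniform_on P A X /\ uniform_on P B Y,
        independent P X Y
      & loss_constant * loss_scale R N <= mul_loss P X Y].
Proof.
move=> M_ge2.
have [s [s_uniq s_prime s_small prod_le size_ge]] := exists_primes_prod_le M_ge2.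
have [_ scale_le] := loss_scale_bounds M_ge2.
pose D := (\prod_(p <- s) p)%N; have D_gt0 : (0 < D)%N := prod_primes_gt0 s_prime.
pose A : {fset nat} := [fset d in divisors D]%fset.
have in_A d : (d \in A) = (d %| D)%N by rewrite !inE dvdn_divisors.
have A_bounds d : d \in A -> (1 <= d <= N)%N.
  rewrite in_A => d_dvd; rewrite (dvdn_gt0 D_gt0) //=.
  by apply: leq_trans prod_le; apply: dvdn_leq.
have card_A : #|` A| = (2 ^ size s)%N.
  by rewrite card_fseq undup_id ?divisors_uniq ?size_divisors_prod_primes.
have A_gt0 : (0 < #|` A|)%N by rewrite card_A expn_gt0.
exists A, A, _, (pair_fdist R A_gt0), (fun w => fsval w.1), (fun w => fsval w.2).
split.
- move=> n n_in; have {n_in} nA : n \in A by case: n_in.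
  split; first exact: A_bounds.
    move=> p; rewrite in_A in nA; apply: leq_trans (dvdn_leq_log p D_gt0 nA) _.
    by rewrite logn_prod_primes // leq_b1.
  move=> p p_n; apply: (allP s_small); rewrite -(perm_mem (primes_prod_primes s_uniq s_prime)).
  move: p_n nA; rewrite in_A !mem_primes => /and3P[-> _ p_dvd] n_dvd.
  by rewrite D_gt0 (dvdn_trans p_dvd).
- by split=> w; apply: A_bounds; apply: fsvalP.
- by split; [exact: uniform_on_fst | exact: uniform_on_snd].
- exact: independent_pairs.
have D2_gt0 : (0 < D ^ 2)%N by rewrite expn_gt0 D_gt0.
have prod_dvd a b : a \in A -> b \in A -> (a * b %| D ^ 2)%N.
  by rewrite !in_A => *; rewrite -mulnn dvdn_mul.
apply: le_trans (mul_loss_pairs_ge R A_gt0 D2_gt0 prod_dvd).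
rewrite card_A size_divisors_sqr_prod_primes // -expnMn !natrX -expr_div_n.
rewrite log2_exp ?divr_gt0 // /loss_constant -[(2 * 2)%N]/4%N.
set t := log2 _; have t_gt0 : 0 < t.
  by have := loss_constant_gt0; rewrite /loss_constant pmulr_lgt0 ?invr_gt0.
have M_gt0 : 0 < (trunc_log 2 (trunc_log 2 N))%:R :> R by rewrite ltr0n ltnW.
move: size_ge; rewrite -(ler_nat R) !natrM => size_ge.
have scale_le8 : loss_scale R N <= 8 * (size s)%:R.
  rewrite -(ler_pM2l M_gt0); lra.
have := ler_wpM2l (ltW t_gt0) scale_le8; lra.
Qed.

Lemma loss_bigO_loss_scale : loss_bigO (loss_scale R).
Proof.
(* The exponent bound 22 L / M, doubled by the passage to loss_scale. *)
exists 44; apply: filterS (near_loglog 2) => N M_ge2 Omega P X Y X_in Y_in.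
have [L_gt0 N_gt0] := loglog_gt1 M_ge2.
have [scale_ge _] := loss_scale_bounds M_ge2.
have XY_gt0 w : (0 < X w * Y w)%N.
  by have /andP[? _] := X_in w; have /andP[? _] := Y_in w; rewrite muln_gt0; apply/andP.
have XY_le w : (X w * Y w <= N ^ 2)%N.
  by have /andP[_ ?] := X_in w; have /andP[_ ?] := Y_in w; rewrite -mulnn leq_mul.
have [e e_le div_le] := exists_size_divisors_bound M_ge2.
apply: le_trans (mul_loss_le _ _ XY_gt0 (fun w => div_le _ (XY_gt0 w) (XY_le w))) _.
  by rewrite expn_gt0.
rewrite log2_exp2 ger0_norm ?loss_scale_ge0 //.
have M_gt0 : 0 < (trunc_log 2 (trunc_log 2 N))%:R :> R by rewrite ltr0n ltnW.
move: e_le; rewrite -(ler_nat R) !natrM => e_le.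
rewrite -(ler_pM2r M_gt0); lra.
Qed.

(** The distributions of [exists_large_mul_loss] satisfy any bound valid for all
    distributions, so [loss_constant * loss_scale R N <= C * `|f N|]. *)
Lemma loss_scale_bigO_of_loss_bigO (f : nat -> R) :
  loss_bigO f -> loss_scale R =O_\oo f.
Proof.
case=> C f_bound; apply/eqO_exP.
have c_gt0 := loss_constant_gt0.
exists ((`|C| + 1) / loss_constant).
  by rewrite divr_gt0 // ltr_wpDl.
apply: filterS2 f_bound (near_loglog 2) => N f_bound M_ge2.
have [A [B [T [P [X [Y [_ [X_in Y_in] _ _ loss_ge]]]]]]] := exists_large_mul_loss M_ge2.
have {loss_ge} loss_le := le_trans loss_ge (f_bound _ P X Y X_in Y_in).
rewrite ger0_norm ?loss_scale_ge0 // mulrAC ler_pdivlMr // mulrC.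
apply: le_trans loss_le _; apply: ler_wpM2r => //.
by have := ler_norm C; lra.
Qed.

End Asymptotics.

Theorem mainTheorem5 (R : realType) :
  (exists (y : nat -> nat) (c : R),
     [/\ subpolynomial R y, 0 < c &
      \forall N \near \oo,
        exists (A B : {fset nat}) (Omega : finType) (P : fdist R Omega)
               (X Y : Omega -> nat),
          [/\ (forall n, n \in A \/ n \in B ->
                 [/\ (1 <= n <= N)%N, distinct_prime_factors n
                   & prime_factors_le (y N) n]),
              ranges_in N X /\ ranges_in N Y,
              uniform_on P A X /\ uniform_on P B Y,
              independent P X Y
            & c * loss_scale R N <= mul_loss P X Y]])
  /\ loss_bigO (loss_scale R)
  /\ (forall f : nat -> R, loss_bigO f -> loss_scale R =O_\oo f).
Proof.
split; last by split; [exact: loss_bigO_loss_scale | exact: loss_scale_bigO_of_loss_bigO].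
exists small_prime_bound, (loss_constant R); split.
- exact: subpolynomial_small_prime_bound.
- exact: loss_constant_gt0.
apply: filterS (near_loglog 2) => N; exact: exists_large_mul_loss.
Qed.
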